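(* Let $X$ be a nonempty completely regular space, $E\neq\{0\}$ and $D$ Banach spaces, and let $A\subset L(D)$ be a Banach algebra of operators isometrically isomorphic, as a Banach algebra, to $C(X,L(E))$; identify the center $\mathbb{Z}(A)$ with $C(X)$ (functions $x\mapsto c(x)I$). Let $G$ be a discrete group and $g\mapsto T_g$ a representation of $G$ by (invertible) isometries of $D$ such that $T_gAT_g^{-1}=A$ for all $g\in G$, and put $\hat T_g(a)=T_gaT_g^{-1}$ for $a\in A$. Assume that there are homeomorphisms $t_g:X\to X$, $g\in G$, such that $[\hat T_g(z)](x)=z(t_g^{-1}(x))$ for all $z\in\mathbb{Z}(A)$, $x\in X$, $g\in G$. If $G$ acts topologically freely, then $B(A,T_g)$ possesses property ( * ).
   Context: All Banach spaces are complex and completely regular spaces are Hausdorff. $L(E)$ is the Banach algebra of bounded linear operators on $E$. For a normed space $B$, $C(X,B)$ is the space of bounded continuous functions $X\to B$ with the sup norm, and $C(X)=C(X,\mathbb{C})$. $B(A,T_g)\subset L(D)$ is the Banach algebra generated by $A$ and $\{T_g\}_{g\in G}$, i.e. the norm closure in $L(D)$ of the set of finite sums $\sum_{g\in F}a_gT_g$ ($F\subset G$ finite, $a_g\in A$). $G$ acts topologically freely if for every $g\in G$, $g\ne e$ ($e$ the identity of $G$), the set $X_g=\{x\in X: t_g(x)=x\}$ has empty interior. Property ( * ): for every finite sum $b=\sum a_gT_g$ with $a_g\in A$ one has $\|b\|=\|\sum a_gT_g\|\ge\|a_e\|$. *)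

(* Defs.v *)
From HB Require Import structures.
From mathcomp Require Import all_boot all_order all_algebra.
From mathcomp Require Import finmap.
From mathcomp Require Import all_classical all_reals all_analysis.
From mathcomp Require Import complex.

Set Implicit Arguments.
Unset Strict Implicit.
Unset Printing Implicit Defensive.

Import Order.TTheory GRing.Theory Num.Theory.
Import numFieldNormedType.Exports.

Local Open Scope classical_set_scope.
Local Open Scope ring_scope.
Local Open Scope complex_scope.

(** Norms of normed spaces over [R[i]] take values in [R[i]]; [rnorm] is the
    same number seen in [R], where suprema exist. *)
Definition rnorm (R : realType) (V : normedModType R[i]) (x : V) : R :=
  complex.Re `|x|.

Section rnorm.
Variables (R : realType) (V : normedModType R[i]).
Implicit Types x y : V.

Lemma rnormE x : (rnorm x)%:C = `|x|.
Proof. by apply: RRe_real; exact: normr_real. Qed.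

Lemma rnorm_ge0 x : 0 <= rnorm x.
Proof. by rewrite -ler0c rnormE. Qed.

Lemma rnorm0 : rnorm (0 : V) = 0.
Proof. by rewrite /rnorm normr0. Qed.

Lemma rnorm_eq0 x : rnorm x = 0 -> x = 0.
Proof. by move=> x0; apply: normr0_eq0; rewrite -rnormE x0. Qed.

Lemma rnormD x y : rnorm (x + y) <= rnorm x + rnorm y.
Proof. by rewrite -lecR rmorphD /= !rnormE ler_normD. Qed.

Lemma rnormN x : rnorm (- x) = rnorm x.
Proof. by rewrite /rnorm normrN. Qed.

Lemma rnormZ (c : R[i]) x : rnorm (c *: x) = complex.Re `|c| * rnorm x.
Proof.
by apply: complexI; rewrite rmorphM /= !rnormE normrZ.
Qed.

End rnorm.

(** The algebra [L(V)] of bounded linear operators on [V]. *)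
Section bounded_op.
Variables (R : realType) (V : normedModType R[i]).

Record bounded_op := BoundedOp {
  bounded_op_fun :> V -> V ;
  bounded_op_linear : linear bounded_op_fun ;
  bounded_op_bounded :
    exists M : R, forall v, rnorm (bounded_op_fun v) <= M * rnorm v }.

HB.instance Definition _ := gen_eqMixin bounded_op.
HB.instance Definition _ := gen_choiceMixin bounded_op.

Implicit Types f g h : bounded_op.

Lemma bounded_op_ext f g : (forall v, f v = g v) -> f = g.
Proof.
move: f g => [f lf bf] [g lg bg] /= /funext fg.
by move: lf bf lg bg; rewrite fg => *; congr BoundedOp; exact: Prop_irrelevance.
Qed.

Lemma bounded_op0 f : f 0 = 0.
Proof.
have := bounded_op_linear f 1 0 0.
by rewrite !scale1r addr0 => /eqP; rewrite -subr_eq0 opprD addrA subrr sub0r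
  oppr_eq0 => /eqP.
Qed.

Lemma bounded_opD f u v : f (u + v) = f u + f v.
Proof. by have := bounded_op_linear f 1 u v; rewrite !scale1r. Qed.

Lemma bounded_opZ f (c : R[i]) v : f (c *: v) = c *: f v.
Proof. by have := bounded_op_linear f c v 0; rewrite bounded_op0 !addr0. Qed.

Lemma bop_zero_linear : linear (fun _ : V => 0 : V).
Proof. by move=> c u v; rewrite scaler0 addr0. Qed.

Lemma bop_zero_bounded :
  exists M : R, forall v : V, rnorm (0 : V) <= M * rnorm v.
Proof. by exists 0 => v; rewrite mul0r rnorm0. Qed.

Definition bop_zero := BoundedOp bop_zero_linear bop_zero_bounded.

Lemma bop_one_linear : linear (fun v : V => v).
Proof. by []. Qed.

Lemma bop_one_bounded : exists M : R, forall v : V, rnorm v <= M * rnorm v.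
Proof. by exists 1 => v; rewrite mul1r. Qed.

Definition bop_one := BoundedOp bop_one_linear bop_one_bounded.

Lemma bop_opp_linear f : linear (fun v => - f v).
Proof. by move=> c u v; rewrite bounded_op_linear opprD scalerN. Qed.

Lemma bop_opp_bounded f :
  exists M : R, forall v, rnorm (- f v) <= M * rnorm v.
Proof.
by have [M fM] := bounded_op_bounded f; exists M => v; rewrite rnormN.
Qed.

Definition bop_opp f := BoundedOp (bop_opp_linear f) (bop_opp_bounded f).

Lemma bop_add_linear f g : linear (fun v => f v + g v).
Proof. by move=> c u v; rewrite !bounded_op_linear scalerDr addrACA. Qed.

Lemma bop_add_bounded f g :
  exists M : R, forall v, rnorm (f v + g v) <= M * rnorm v.
Proof.
have [M fM] := bounded_op_bounded f; have [N gN] := bounded_op_bounded g.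
by exists (M + N) => v; rewrite mulrDl (le_trans (rnormD _ _))// lerD.
Qed.

Definition bop_add f g := BoundedOp (bop_add_linear f g) (bop_add_bounded f g).

Lemma bop_scale_linear (a : R[i]) f : linear (fun v => a *: f v).
Proof.
by move=> c u v; rewrite bounded_op_linear scalerDr !scalerA [a * c]mulrC.
Qed.

Lemma bop_scale_bounded (a : R[i]) f :
  exists M : R, forall v, rnorm (a *: f v) <= M * rnorm v.
Proof.
have [M fM] := bounded_op_bounded f.
exists (complex.Re `|a| * M) => v; rewrite rnormZ -mulrA ler_wpM2l//.
by rewrite -ler0c RRe_real ?normr_real.
Qed.

Definition bop_scale a f :=
  BoundedOp (bop_scale_linear a f) (bop_scale_bounded a f).

Lemma bop_mul_linear f g : linear (fun v => f (g v)).
Proof. by move=> c u v; rewrite !bounded_op_linear. Qed.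

Lemma bop_mul_bounded f g :
  exists M : R, forall v, rnorm (f (g v)) <= M * rnorm v.
Proof.
have [M fM] := bounded_op_bounded f; have [N gN] := bounded_op_bounded g.
exists (`|M| * N) => v; rewrite (le_trans (fM _))//.
rewrite (@le_trans _ _ (`|M| * rnorm (g v)))//.
  by rewrite ler_wpM2r ?rnorm_ge0// ler_norm.
by rewrite -mulrA ler_wpM2l.
Qed.

Definition bop_mul f g := BoundedOp (bop_mul_linear f g) (bop_mul_bounded f g).

Fact bop_addA : associative bop_add.
Proof. by move=> f g h; apply: bounded_op_ext => v /=; rewrite addrA. Qed.

Fact bop_addC : commutative bop_add.
Proof. by move=> f g; apply: bounded_op_ext => v /=; rewrite addrC. Qed.

Fact bop_add0 : left_id bop_zero bop_add.
Proof. by move=> f; apply: bounded_op_ext => v /=; rewrite add0r. Qed.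

Fact bop_addN : left_inverse bop_zero bop_opp bop_add.
Proof. by move=> f; apply: bounded_op_ext => v /=; rewrite addNr. Qed.

HB.instance Definition _ :=
  GRing.isZmodule.Build bounded_op bop_addA bop_addC bop_add0 bop_addN.

Fact bop_mulA : associative bop_mul.
Proof. by move=> f g h; apply: bounded_op_ext. Qed.

Fact bop_mul1l : left_id bop_one bop_mul.
Proof. by move=> f; apply: bounded_op_ext. Qed.

Fact bop_mul1r : right_id bop_one bop_mul.
Proof. by move=> f; apply: bounded_op_ext. Qed.

Fact bop_mulDl : left_distributive bop_mul +%R.
Proof. by move=> f g h; apply: bounded_op_ext. Qed.

Fact bop_mulDr : right_distributive bop_mul +%R.
Proof.
by move=> f g h; apply: bounded_op_ext => v; exact: bounded_opD.
Qed.

HB.instance Definition _ := GRing.Zmodule_isPzRing.Build bounded_op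
  bop_mulA bop_mul1l bop_mul1r bop_mulDl bop_mulDr.

Fact bop_scaleA (a b : R[i]) f :
  bop_scale a (bop_scale b f) = bop_scale (a * b) f.
Proof. by apply: bounded_op_ext => v /=; rewrite scalerA. Qed.

Fact bop_scale1 : left_id 1 bop_scale.
Proof. by move=> f; apply: bounded_op_ext => v /=; rewrite scale1r. Qed.

Fact bop_scaleDr : right_distributive bop_scale +%R.
Proof. by move=> a f g; apply: bounded_op_ext => v; exact: scalerDr. Qed.

Fact bop_scaleDl f : {morph bop_scale^~ f : a b / a + b}.
Proof. by move=> a b; apply: bounded_op_ext => v; exact: scalerDl. Qed.

HB.instance Definition _ := GRing.Zmodule_isLmodule.Build R[i] bounded_op
  bop_scaleA bop_scale1 bop_scaleDr bop_scaleDl.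

Definition opnorm f : R :=
  sup [set rnorm (f v) | v in [set v | rnorm v <= 1]].

Lemma opnorm_has_sup f :
  has_sup [set rnorm (f v) | v in [set v | rnorm v <= 1]].
Proof.
split; first by exists (rnorm (f 0)); exists 0 => //=; rewrite rnorm0.
have [M fM] := bounded_op_bounded f.
exists `|M| => _ [v /= v1 <-]; rewrite (le_trans (fM _))//.
rewrite (@le_trans _ _ (`|M| * rnorm v))//.
  by rewrite ler_wpM2r ?rnorm_ge0// ler_norm.
by rewrite -[leRHS]mulr1 ler_wpM2l.
Qed.

Lemma rnorm_le_opnorm f v : rnorm (f v) <= opnorm f * rnorm v.
Proof.
have [->|v0] := eqVneq v 0; first by rewrite bounded_op0 rnorm0 mulr0.
have nv0 : 0 < rnorm v.
  by rewrite lt_neqAle rnorm_ge0 andbT eq_sym; apply: contra_neq v0 => /rnorm_eq0.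
pose c : R[i] := (rnorm v)^-1%:C.
have cE : complex.Re `|c| = (rnorm v)^-1.
  by rewrite ger0_norm// ler0c invr_ge0 ltW.
have : rnorm (f (c *: v)) <= opnorm f.
  apply: ub_le_sup; first exact: (opnorm_has_sup f).2.
  by exists (c *: v) => //=; rewrite rnormZ cE mulVf// gt_eqF.
by rewrite bounded_opZ rnormZ cE mulrC ler_pdivrMr.
Qed.

Lemma opnorm_le f (M : R) : 0 <= M ->
  (forall v, rnorm (f v) <= M * rnorm v) -> opnorm f <= M.
Proof.
move=> M0 fM; apply: ge_sup; first exact: (opnorm_has_sup f).1.
move=> _ [v /= v1 <-]; rewrite (le_trans (fM v))//.
by rewrite -[leRHS]mulr1 ler_wpM2l.
Qed.

Lemma opnorm_ge0 f : 0 <= opnorm f.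
Proof.
apply: (@le_trans _ _ (rnorm (f 0))); first exact: rnorm_ge0.
apply: ub_le_sup; first exact: (opnorm_has_sup f).2.
by exists 0 => //=; rewrite rnorm0.
Qed.

Lemma opnormD f g : opnorm (f + g) <= opnorm f + opnorm g.
Proof.
apply: opnorm_le => [|v]; first by rewrite addr_ge0 ?opnorm_ge0.
by rewrite (le_trans (rnormD _ _))// mulrDl lerD// rnorm_le_opnorm.
Qed.

Lemma opnormZ_le (c : R[i]) f :
  opnorm (c *: f) <= complex.Re `|c| * opnorm f.
Proof.
have c0 : 0 <= complex.Re `|c| by rewrite -ler0c RRe_real ?normr_real.
apply: opnorm_le => [|v]; first by rewrite mulr_ge0// opnorm_ge0.
by rewrite rnormZ -mulrA ler_wpM2l// rnorm_le_opnorm.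
Qed.

Fact bop_normD f g : (opnorm (f + g))%:C <= (opnorm f)%:C + (opnorm g)%:C.
Proof. by rewrite -rmorphD /= lecR opnormD. Qed.

Fact bop_normZ (c : R[i]) f : (opnorm (c *: f))%:C = `|c| * (opnorm f)%:C.
Proof.
have ReE (z : R[i]) : (complex.Re `|z|)%:C = `|z|.
  by rewrite RRe_real ?normr_real.
apply/eqP; rewrite eq_le; apply/andP; split.
  by rewrite -ReE -rmorphM /= lecR opnormZ_le.
have [->|c0] := eqVneq c 0; first by rewrite normr0 mul0r ler0c opnorm_ge0.
have := opnormZ_le c^-1 (c *: f).
rewrite scalerA mulVf// scale1r -lecR rmorphM /= ReE normfV.
by rewrite mulrC ler_pdivlMr ?normr_gt0// mulrC.
Qed.

Fact bop_norm_eq0 f : (opnorm f)%:C = 0 -> f = 0.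
Proof.
move=> /complexI f0; apply: bounded_op_ext => v; apply: rnorm_eq0.
apply/eqP; rewrite eq_le rnorm_ge0 andbT.
by rewrite (le_trans (rnorm_le_opnorm _ _))// f0 mul0r.
Qed.

HB.instance Definition _ := Lmodule_isNormed.Build R[i] bounded_op
  bop_normD bop_normZ bop_norm_eq0.

Lemma bop_normE f : `|f| = (opnorm f)%:C.
Proof. by []. Qed.

End bounded_op.

Notation "''L(' V )" := (bounded_op V) (at level 8, format "''L(' V )").

Section function_spaces.
Variables (R : realType) (X : topologicalType) (B : normedModType R[i]).

(** [C(X, B)] *)
Definition bounded_continuous : set (X -> B) :=
  [set f | continuous f /\ bounded_fun f].

Definition supnorm (f : X -> B) : R := sup (range (fun x => rnorm (f x))).

End function_spaces.

Section operator_algebras.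
Variables (R : realType) (D : normedModType R[i]).

(** Completeness of the subalgebra is closedness in [L(D)], [D] being complete.
    The identity of [D] is not required to belong to it. *)
Record banach_subalgebra (A : set 'L(D)) : Prop := BanachSubalgebra {
  banach_subalgebra0 : A 0 ;
  banach_subalgebraP : forall (c : R[i]) a b, A a -> A b -> A (c *: a + b) ;
  banach_subalgebraM : forall a b, A a -> A b -> A (a * b) ;
  banach_subalgebra_closed : closed A }.

(** When [A] is [C(X, L(E))], the center of [L(E)] being the scalars, this is the
    set of the functions [x |-> c(x) I], i.e. a copy of [C(X)]. *)
Definition alg_center (A : set 'L(D)) : set 'L(D) :=
  [set z | A z /\ forall a, A a -> z * a = a * z].

(** [phi], relevant only on [A], is an isometric isomorphism of Banach algebras
    from [A] onto [C(X, L(E))]; [phi a x] is the value [a(x)]. *)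
Record isometric_isomorphism (X : topologicalType) (E : normedModType R[i])
  (A : set 'L(D)) (phi : 'L(D) -> X -> 'L(E)) : Prop := IsometricIsomorphism {
  iso_bij : set_bij A (@bounded_continuous R X 'L(E)) phi ;
  iso_linear : forall (c : R[i]) a b x, A a -> A b ->
    phi (c *: a + b) x = c *: phi a x + phi b x ;
  iso_mul : forall a b x, A a -> A b -> phi (a * b) x = phi a x * phi b x ;
  iso_norm : forall a, A a -> rnorm a = supnorm (phi a) }.

Variables (G : groupType).
Local Notation e := (1%g : G).

(** The operators [T g] are then automatically invertible, the inverse of [T g]
    being [T g^-1]. *)
Record isometric_representation (T : G -> 'L(D)) : Prop :=
  IsometricRepresentation {
  repr_one : T e = 1 ;
  repr_mul : forall g h, T (g * h)%g = T g * T h ;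
  repr_isometry : forall g v, `|T g v| = `|v| }.

Definition That (T : G -> 'L(D)) (g : G) (a : 'L(D)) : 'L(D) :=
  T g * a * T g^-1%g.

(** A finite sum of terms [a_g T_g] is given by a family [a] of elements of [A]
    vanishing off a finite set [F]; thus [a e = 0] when the sum has no [e]-term. *)
Definition coef_family (A : set 'L(D)) (F : {fset G}) (a : G -> 'L(D)) :=
  (forall g, A (a g)) /\ (forall g, g \notin F -> a g = 0).

Definition finite_sums (A : set 'L(D)) (T : G -> 'L(D)) : set 'L(D) :=
  [set b | exists F a, coef_family A F a /\ b = \sum_(g <- F) a g * T g].

(** [B(A, T_g)] *)
Definition gen_algebra (A : set 'L(D)) (T : G -> 'L(D)) : set 'L(D) :=
  closure (finite_sums A T).

Lemma finite_sums_gen_algebra (A : set 'L(D)) (T : G -> 'L(D)) :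
  finite_sums A T `<=` gen_algebra A T.
Proof. exact: subset_closure. Qed.

(** By [finite_sums_gen_algebra], the first hypothesis on [b] is implied by the
    last one. *)
Definition property_star (A : set 'L(D)) (T : G -> 'L(D)) :=
  forall b, gen_algebra A T b ->
  forall (F : {fset G}) (a : G -> 'L(D)), coef_family A F a ->
  b = \sum_(g <- F) a g * T g -> `|a e| <= `|b|.

End operator_algebras.

Section actions.
Variables (X : topologicalType) (G : groupType).

Definition homeomorphism_with_inverse (f f' : X -> X) :=
  [/\ cancel f f', cancel f' f, continuous f & continuous f'].

Definition topologically_free (t : G -> X -> X) :=
  forall g : G, g <> 1%g -> [set x | t g x = x]^° = set0.

End actions.

(* Main.v *)
Require Import Defs.
From mathcomp Require Import all_boot all_order all_algebra.
From mathcomp Require Import finmap.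
From mathcomp Require Import all_classical all_reals all_analysis.
From mathcomp Require Import complex.

Set Implicit Arguments.
Unset Strict Implicit.
Unset Printing Implicit Defensive.

Import Order.TTheory GRing.Theory Num.Theory.
Import numFieldNormedType.Exports.

Local Open Scope classical_set_scope.
Local Open Scope ring_scope.

(** Where [a_e] nearly attains its norm, topological freeness provides a point
    [x] and an open neighbourhood [W] of [x] with [t_g^-1(W)] disjoint from [W]
    for every [g <> e] in the finite support of the sum.  Let [z] be the central
    element given by a function [0 <= c <= 1] with [c(x) = 1] vanishing off [W].
    Then [z a_g T_g z = z a_g That_g(z) T_g] is zero unless [g = e], so
    [z b z = z a_e z], and [||b|| >= ||z b z|| = ||z a_e z|| >= ||a_e(x)||]. *)

Section norms.
Variables (R : realType) (V : normedModType R[i]).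

Lemma rnormM_le (f g : 'L(V)) : rnorm (f * g) <= rnorm f * rnorm g.
Proof.
apply: opnorm_le => [|v]; first by rewrite mulr_ge0 ?opnorm_ge0.
rewrite (le_trans (rnorm_le_opnorm f (g v)))// -mulrA.
by rewrite ler_wpM2l ?opnorm_ge0 ?rnorm_le_opnorm.
Qed.

Lemma bop_scalar_mull (c : R[i]) (f : 'L(V)) : (c *: (1 : 'L(V))) * f = c *: f.
Proof. exact: bounded_op_ext. Qed.

Lemma bop_scalar_mulr (c : R[i]) (f : 'L(V)) : f * (c *: (1 : 'L(V))) = c *: f.
Proof. by apply: bounded_op_ext => v; exact: bounded_opZ. Qed.

Lemma rnorm_bop1_le : rnorm (1 : 'L(V)) <= 1.
Proof. by apply: opnorm_le => // v; rewrite mul1r. Qed.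

Lemma rnorm_real_scale (c : R) (x : V) : rnorm (c%:C%C *: x) = `|c| * rnorm x.
Proof. by rewrite rnormZ normc_def /= expr0n/= addr0 sqrtr_sqr. Qed.

Lemma rnormB_ge (x y : V) : rnorm x - rnorm y <= rnorm (x - y).
Proof. by rewrite lerBlDr -{1}(subrK y x) rnormD. Qed.

(** Distances in [V] take values in [R[i]], but a positive element of [R[i]] is real, so real radii
    suffice. *)
Lemma cvg_rnormP (X : topologicalType) (f : X -> V) (x : X) :
  f y @[y --> x] --> f x <->
  forall d : R, 0 < d -> \forall y \near x, rnorm (f x - f y) < d.
Proof.
split=> [/cvgrPdist_lt fx d d0|fx].
  have dC : 0 < d%:C%C by rewrite ltcR.
  by near do rewrite -ltcR rnormE; exact: fx.
apply/cvgrPdist_lt => d d0.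
have dE : d = (complex.Re d)%:C%C by rewrite RRe_real// gtr0_real.
rewrite dE; move: d0; rewrite dE ltcR => d0.
by near do rewrite -rnormE ltcR; exact: fx.
Unshelve. all: by end_near. Qed.

(** Reverse triangle inequality with radius [rnorm (f x) - M]. It makes the region where the norm of
    [a_e(x)] exceeds that of [b] open. *)
Lemma open_rnorm_gt (X : topologicalType) (f : X -> V) (M : R) :
  continuous f -> open [set x | M < rnorm (f x)].
Proof.
move=> fc; rewrite openE => x /= Mx.
have /(cvg_rnormP _ _).1/(_ _ _) := fc x; rewrite -subr_gt0 in Mx.
move=> /(_ _ Mx); apply: filterS => y; rewrite /= => fxy.
have := le_lt_trans (rnormB_ge _ _) fxy.
by rewrite ltrD2l ltrN2.
Qed.

Lemma continuous_real_scale (X : topologicalType) (c : X -> R) (v : V) :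
  continuous c -> continuous (fun x => (c x)%:C%C *: v).
Proof.
move=> cc x; apply/cvg_rnormP => d d0.
(* The added 1 keeps the divisor positive when [v = 0]. *)
have v1 : 0 < rnorm v + 1 by rewrite ltr_wpDl ?rnorm_ge0.
have /cvgrPdist_lt/(_ _ (divr_gt0 d0 v1)) := cc x.
apply: filterS => y cxy.
rewrite -scalerBl -rmorphB rnorm_real_scale.
rewrite (@le_lt_trans _ _ (`|c x - c y| * (rnorm v + 1)))//.
  by rewrite ler_wpM2l// lerDl.
by rewrite -ltr_pdivlMr.
Qed.

Lemma bounded_fun_rnormP (X : topologicalType) (f : X -> V) :
  bounded_fun f <-> exists M : R, forall x, rnorm (f x) <= M.
Proof.
split=> [[M [Mreal fM]]|[M fM]].
  (* [bounded_fun] only promises the bounds strictly above [M]. *)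
  exists (complex.Re M + 1) => x.
  rewrite -lecR rnormE rmorphD /= RRe_real//.
  by apply: (fM (M + 1)) => //; rewrite ltrDl.
exists M%:C%C; split=> [|N MN x _ /=]; first by apply/complex_realP; exists M.
by rewrite (le_trans _ (ltW MN))// -rnormE lecR.
Qed.

End norms.

Section function_spaces.
Variables (R : realType) (X : topologicalType) (B : normedModType R[i]).
Implicit Types f : X -> B.

Lemma supnorm_ub f x : bounded_fun f -> rnorm (f x) <= supnorm f.
Proof.
move=> /bounded_fun_rnormP[M fM].
apply: ub_le_sup; last by exists x.
by exists M => _ [y _ <-].
Qed.

(** On an empty [X] the supremum takes the default value 0, while [M] could be negative. *)
Lemma supnorm_le f (M : R) : [set: X] !=set0 ->
  (forall x, rnorm (f x) <= M) -> supnorm f <= M.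
Proof.
move=> [x _] fM; apply: ge_sup; first by exists (rnorm (f x)); exists x.
by move=> _ [y _ <-].
Qed.

Lemma supnorm_gtP f (M : R) : [set: X] !=set0 ->
  M < supnorm f -> exists x, M < rnorm (f x).
Proof.
move=> X0; apply: contraPP => /forallNP fM; apply/negP.
by rewrite -leNgt supnorm_le// => x; rewrite leNgt; apply/negP.
Qed.

End function_spaces.

Lemma completely_regular_bump (R : realType) (X : topologicalType)
    (W : set X) (x : X) :
  completely_regular_space X -> open W -> W x ->
  exists c : X -> R, [/\ continuous c, forall y, 0 <= c y <= 1, c x = 1 &
    forall y, ~ W y -> c y = 0].
Proof.
move=> crX oW Wx; have [||f [fc f01 fx fW]] :=
  (@uniform_separatorP _ R _ _).1 (crX x (~` W) _ _).
- by rewrite closedC.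
- by move=> /(_ Wx).
(* The separating function [f] is 0 at [x] and 1 off [W]. *)
exists (fun y => 1 - f y); split.
- by move=> y; apply: cvgB; [exact: cvg_cst|exact: fc].
- move=> y; have /= := f01 (f y) (ex_intro2 _ _ y I erefl).
  by rewrite in_itv/= => /andP[? ?]; rewrite subr_ge0 gerBl; apply/andP.
- by rewrite (fx (f x)) ?subr0//; exists x.
- by move=> y Wy; rewrite (fW (f y)) ?subrr//; exists y.
Qed.

Section topologically_free.
Variables (X : topologicalType) (G : groupType) (t t' : G -> X -> X).
Hypothesis X_hausdorff : hausdorff_space X.
Hypothesis t_homeo : forall g, homeomorphism_with_inverse (t g) (t' g).
Hypothesis t_free : topologically_free t.

(** Induction on [s], shrinking [W] once for each [g]; the conditions already obtained pass to
    subsets. *)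
Lemma topologically_free_wandering (s : seq G) (U : set X) :
  open U -> U !=set0 ->
  exists W : set X, [/\ open W, W !=set0, W `<=` U &
    forall g, g \in s -> g <> 1%g -> forall y, W y -> ~ W (t' g y)].
Proof.
move=> oU U0; elim: s => [|g s [W [oW W0 WU Ws]]]; first by exists U; split.
have [g1|g1] := pselect (g = 1%g).
  by exists W; split=> // h; rewrite inE => /predU1P[->|/Ws].
(* Otherwise [t g] would fix the nonempty open set [W] pointwise, against topological freeness. *)
have [x [Wx tgx]] : exists x, W x /\ t g x <> x.
  apply: contrapT => /forallNP Wfix; case: W0 => x Wx.
  suff : [set x | t g x = x]^° x by rewrite (t_free g1).
  apply: (filterS _ (open_nbhs_nbhs (conj oW Wx))).
  by move=> y Wy; apply: contrapT => tgy; exact: (Wfix y).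
have [_ t'K _ t'c] := t_homeo g.
have /eqP xt'x : x <> t' g x by move=> /(congr1 (t g)); rewrite t'K.
move: X_hausdorff; rewrite open_hausdorff => /(_ _ _ xt'x)[[P Q] /=].
move=> [/set_mem Px /set_mem Qx] [oP oQ /eqP/seteqP[PQ _]].
(* The new set lies in [P] and [t' g] sends it into [Q], which is disjoint from [P]. *)
exists (W `&` P `&` t' g @^-1` Q); split.
- apply: openI; first exact: openI.
  by apply: open_comp => // y _; exact: t'c.
- by exists x.
- by move=> y [[/WU]].
- move=> h; rewrite inE => /predU1P[-> _ y [_ Qy] [[_ Py] _]|hs h1 y].
    exact: (PQ (t' g y)).
  by move=> [[Wy _] _] [[Wty _] _]; exact: (Ws h hs h1 y Wy).
Qed.

End topologically_free.

Section operator_algebra.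
Variables (R : realType) (X : topologicalType) (E D : normedModType R[i]).
Variables (A : set 'L(D)) (phi : 'L(D) -> X -> 'L(E)).
Hypothesis A_banach : banach_subalgebra A.
Hypothesis phi_iso : isometric_isomorphism A phi.

Lemma iso_bounded_continuous a :
  A a -> continuous (phi a) /\ bounded_fun (phi a).
Proof. by move=> Aa; have [fA _ _] := iso_bij phi_iso; exact: fA. Qed.

Lemma iso_inj a b : A a -> A b -> (forall x, phi a x = phi b x) -> a = b.
Proof.
move=> Aa Ab ab; have [_ injA _] := iso_bij phi_iso.
by apply: injA; rewrite ?inE//; exact/funext.
Qed.

Lemma iso0 x : phi 0 x = 0.
Proof.
have A0 := banach_subalgebra0 A_banach.
have := iso_linear phi_iso 1 x A0 A0.
by rewrite !scale1r addr0 -[LHS]addr0 => /addrI.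
Qed.

Lemma rnorm_iso_le a x : A a -> rnorm (phi a x) <= rnorm a.
Proof.
move=> Aa; rewrite (iso_norm phi_iso Aa); apply: supnorm_ub.
exact: (iso_bounded_continuous Aa).2.
Qed.

(** [z] comes from the surjectivity of [phi]. It is central because scalar values commute with
    everything pointwise and [phi] is injective on [A]. *)
Lemma central_scalar_function (c : X -> R) : [set: X] !=set0 ->
  continuous c -> (forall y, 0 <= c y <= 1) ->
  exists z, [/\ alg_center A z, rnorm z <= 1 &
    forall y, phi z y = (c y)%:C%C *: (1 : 'L(E))].
Proof.
move=> X0 cc c01; pose f y : 'L(E) := (c y)%:C%C *: (1 : 'L(E)).
have f1 y : rnorm (f y) <= 1.
  have /andP[c0 c1] := c01 y.
  by rewrite /f rnorm_real_scale ger0_norm// mulr_ile1 ?rnorm_ge0 ?rnorm_bop1_le.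
have fbc : bounded_continuous f.
  split; first exact: continuous_real_scale.
  by apply/bounded_fun_rnormP; exists 1.
have [_ _ /(_ f fbc)[z Az zf]] := iso_bij phi_iso.
exists z; split; last by move=> y; rewrite zf.
- split=> // a Aa; have MA := banach_subalgebraM A_banach.
  apply: iso_inj => [||y]; [exact: MA|exact: MA|].
  by rewrite !(iso_mul phi_iso)// zf /f bop_scalar_mull bop_scalar_mulr.
- by rewrite (iso_norm phi_iso Az) zf; exact: supnorm_le.
Qed.

End operator_algebra.

Theorem theorem2p8 (R : realType) (X : topologicalType)
  (E D : completeNormedModType R[i]) (A : set 'L(D))
  (phi : 'L(D) -> X -> 'L(E)) (G : groupType) (T : G -> 'L(D))
  (t t' : G -> X -> X)
  (X_nonempty : [set: X] !=set0)
  (X_hausdorff : hausdorff_space X)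
  (X_completely_regular : completely_regular_space X)
  (E_neq0 : exists u : E, u <> 0)
  (A_banach : banach_subalgebra A)
  (phi_iso : isometric_isomorphism A phi)
  (T_repr : isometric_representation T)
  (T_normalizes : forall g, That T g @` A = A)
  (t_homeo : forall g, homeomorphism_with_inverse (t g) (t' g))
  (t_That : forall g z x, alg_center A z -> phi (That T g z) x = phi z (t' g x))
  (t_free : topologically_free t) :
  property_star A T.
Proof.
move=> b _ F a [Aa aF] bE; rewrite -!rnormE lecR.
have [eF|eF] := boolP (1%g \in F); last by rewrite aF// rnorm0 rnorm_ge0.
rewrite leNgt; apply/negP => ba.
(* If the norm of [a_e] exceeds that of [b], so does the norm of some value of [a_e]; [W] is then
   taken inside the open set of all such points. *)
have [x0 bx0] : exists x, rnorm b < rnorm (phi (a 1%g) x).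
  by apply: supnorm_gtP; rewrite -?(iso_norm phi_iso).
have [phic _] := iso_bounded_continuous phi_iso (Aa 1%g).
have [|W [oW [x Wx] WU Wt]] := topologically_free_wandering X_hausdorff t_homeo
  t_free F (open_rnorm_gt (rnorm b) phic); first by exists x0.
have [c [cc c01 cx cW]] :=
  completely_regular_bump R X_completely_regular oW Wx.
have [z [zc z1 zE]] :=
  central_scalar_function A_banach phi_iso X_nonempty cc c01.
have [Az zC] := zc; have MA := banach_subalgebraM A_banach.
have off g : g \in F -> g <> 1%g -> z * (a g * T g) * z = 0.
  move=> gF g1; have AzT : A (That T g z).
    by rewrite -(T_normalizes g); exists z.
  have -> : z * (a g * T g) * z = z * (a g * That T g z) * T g.
    rewrite /That !mulrA -[X in _ = X]mulrA -(repr_mul T_repr) mulVg.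
    by rewrite (repr_one T_repr) mulr1.
  suff -> : z * (a g * That T g z) = 0 by rewrite mul0r.
  apply: (iso_inj phi_iso) => [||y].
  - by apply: (MA) => //; exact: MA.
  - exact: banach_subalgebra0 A_banach.
  rewrite (iso0 A_banach phi_iso) 2?(iso_mul phi_iso)//; last exact: MA.
  (* The value at [y] is [c y * c (t' g y)] times that of [a g], and [y] and [t' g y] are never both
     in [W]. *)
  rewrite t_That// !zE bop_scalar_mull bop_scalar_mulr scalerA.
  have [Wy|/cW ->] := pselect (W y); last by rewrite mul0r scale0r.
  by rewrite (cW (t' g y)) ?mulr0 ?scale0r//; exact: Wt.
have zbz : z * b * z = z * a 1%g * z.
  rewrite bE mulr_sumr mulr_suml (big_fsetD1 1%g)//= big_seq big1.
    by rewrite addr0 (repr_one T_repr) mulr1.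
  by move=> g; rewrite !inE => /andP[/eqP g1 gF]; exact: off.
have zbz_le : rnorm (z * b * z) <= rnorm b.
  rewrite (le_trans (rnormM_le _ _))//.
  rewrite (@le_trans _ _ (rnorm (z * b)))//.
    by rewrite ler_piMr ?rnorm_ge0.
  by rewrite (le_trans (rnormM_le _ _))// ler_piMl ?rnorm_ge0.
have zaz_ge : rnorm (phi (a 1%g) x) <= rnorm (z * a 1%g * z).
  have -> : phi (a 1%g) x = phi (z * a 1%g * z) x.
    rewrite !(iso_mul phi_iso)//; last exact: MA.
    by rewrite zE cx bop_scalar_mull bop_scalar_mulr !scale1r.
  by apply: (rnorm_iso_le phi_iso); apply: (MA) => //; exact: MA.
(* Since [x] lies in [W], this makes the norm of [z * b * z] exceed that of [b], contradicting
   [zbz_le]. *)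
have := lt_le_trans (WU x Wx) zaz_ge.
by rewrite -zbz ltNge zbz_le.
Qed.
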